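(* Let $A,C,Q,R,p_1,p_2$ be as in the context, let $\operatorname{tr}S(p)$ and $\operatorname{tr}V(p)$, $p\in[0,1]$, be the extended-real-valued bounds defined in the context, and let $M>0$. Then the optimal solution of the problem $$\underset{p\in[0,1]}{\text{minimize}}\ \operatorname{tr}V(p)\quad\text{subject to}\quad \operatorname{tr}S(p)\ge M$$ is given by $$p^\star=\max\{p\in[0,1]:\ \operatorname{tr}S(p)\ge M\},$$ that is, this maximum is attained and $p^\star$ is a minimizer of the problem.
   Context: $A\in\mathbb{R}^{n\times n}$ has spectral radius $\rho(A)>1$, $C\in\mathbb{R}^{m\times n}$, and $Q\in\mathbb{R}^{n\times n}$, $R\in\mathbb{R}^{m\times m}$ are symmetric positive definite; $(A,Q^{1/2})$ is stabilizable and $(A,C)$ is detectable. $p_1,p_2\in[0,1]$. The symbol $\succeq$ denotes the positive semidefinite order. For $\lambda\in[0,1]$ and $X\succeq0$ in $\mathbb{R}^{n\times n}$ define $$g_\lambda(X)=AXA^{\intercal}+Q-\lambda AXC^{\intercal}(CXC^{\intercal}+R)^{-1}CXA^{\intercal}.$$ Lower bound $S(p)$: let $p_\ell=1-1/\rho^2(A)$. If $pp_2>p_\ell$, $S(p)$ is the positive definite solution of $S(p)=(1-pp_2)AS(p)A^{\intercal}+Q$; if $pp_2\le p_\ell$, $\operatorname{tr}S(p)$ is defined to be $\infty$. Upper bound $V(p)$: let $p_u=\inf\{\lambda\in[0,1]:\ \exists X\succeq0\text{ with }X\succeq g_\lambda(X)\}$. If $pp_1>p_u$, $V(p)$ is the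 positive definite solution of $V(p)=g_{pp_1}(V(p))$; if $pp_1\le p_u$, $\operatorname{tr}V(p)$ is defined to be $\infty$. It may be taken as known (Sinopoli et al., 2004) that these positive definite solutions exist and are unique in the stated ranges, and that in those ranges $S(p)=\lim_k S_k$ with $S_0=0$, $S_{k+1}=(1-pp_2)AS_kA^{\intercal}+Q$, and $V(p)=\lim_k V_k$ with $V_{k+1}=g_{pp_1}(V_k)$ for any $V_0\succ0$. (Interpretation: $\operatorname{tr}S(p)$ and $\operatorname{tr}V(p)$ are respectively an asymptotic lower bound on the eavesdropper's and an asymptotic upper bound on the user's expected prediction error when measurements of the system $x(k+1)=Ax(k)+w(k)$, $y(k)=Cx(k)+v(k)$ are sent with probability $p$ and received with probabilities $p_2$ and $p_1$ respectively.) *)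

(* Defs.v *)
From HB Require Import structures.
From mathcomp Require Import all_boot all_order all_algebra.
From mathcomp Require Import all_classical all_reals.
From mathcomp Require Import complex.

Set Implicit Arguments.
Unset Strict Implicit.
Unset Printing Implicit Defensive.

Import Order.TTheory GRing.Theory Num.Theory.
Local Open Scope classical_set_scope.
Local Open Scope ring_scope.

Definition psd (R : realType) (n : nat) (X : 'M[R]_n) : Prop :=
  X^T = X /\ forall v : 'cV[R]_n, 0 <= (v^T *m X *m v) ord0 ord0.

Definition posdef (R : realType) (n : nat) (X : 'M[R]_n) : Prop :=
  X^T = X /\ forall v : 'cV[R]_n, v != 0 -> 0 < (v^T *m X *m v) ord0 ord0.

(* X >= Y in the positive semidefinite order. *)
Definition loewner_ge (R : realType) (n : nat) (X Y : 'M[R]_n) : Prop :=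
  psd (X - Y).

(* The eigenvalues are those of A viewed as a complex matrix; their set is
   finite, and nonempty as soon as n > 0. *)
Definition spectral_radius (R : realType) (n : nat) (A : 'M[R]_n) : R :=
  sup [set ComplexField.Normc.normc z | z in
        [set z : R[i] | eigenvalue (map_mx (real_complex R) A) z]].

Definition stabilizable (R : realType) (n k : nat)
    (A : 'M[R]_n) (B : 'M[R]_(n, k)) : Prop :=
  exists K : 'M[R]_(k, n), spectral_radius (A + B *m K) < 1.

Definition detectable (R : realType) (n m : nat)
    (A : 'M[R]_n) (C : 'M[R]_(m, n)) : Prop :=
  exists L : 'M[R]_(n, m), spectral_radius (A + L *m C) < 1.

Definition psd_sqrt (R : realType) (n : nat) (Qh Q : 'M[R]_n) : Prop :=
  psd Qh /\ Qh *m Qh = Q.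

Section Bounds.
Variables (R : realType) (n m : nat).
Variables (A : 'M[R]_n) (C : 'M[R]_(m, n)) (Q : 'M[R]_n) (Rv : 'M[R]_m).

Definition riccati (l : R) (X : 'M[R]_n) : 'M[R]_n :=
  A *m X *m A^T + Q
  - l *: (A *m X *m C^T *m invmx (C *m X *m C^T + Rv) *m C *m X *m A^T).

Definition p_lower : R := 1 - (spectral_radius A ^+ 2)^-1.

Definition p_upper : R :=
  inf [set l : R | 0 <= l <= 1 /\
        exists X : 'M[R]_n, psd X /\ loewner_ge X (riccati l X)].

(* The family S is only constrained where the Lyapunov equation is meant to
   have a (unique) positive definite solution; elsewhere trS ignores it. *)
Definition lyapunov_family (p2 : R) (S : R -> 'M[R]_n) : Prop :=
  forall p : R, 0 <= p <= 1 -> p_lower < p * p2 ->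
    posdef (S p) /\ S p = (1 - p * p2) *: (A *m S p *m A^T) + Q.

Definition riccati_family (p1 : R) (V : R -> 'M[R]_n) : Prop :=
  forall p : R, 0 <= p <= 1 -> p_upper < p * p1 ->
    posdef (V p) /\ V p = riccati (p * p1) (V p).

Definition trS (p2 : R) (S : R -> 'M[R]_n) (p : R) : \bar R :=
  if p_lower < p * p2 then (\tr (S p))%:E else +oo%E.

Definition trV (p1 : R) (V : R -> 'M[R]_n) (p : R) : \bar R :=
  if p_upper < p * p1 then (\tr (V p))%:E else +oo%E.

Definition feasible (p2 : R) (S : R -> 'M[R]_n) (M : R) : set R :=
  [set p : R | 0 <= p <= 1 /\ (M%:E <= trS p2 S p)%E].

End Bounds.

(* Main.v *)
(** The maps X |-> a A X A^T + Q and g_l are monotone on psd matrices and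
    satisfy F (t X) >= t F X + (1 - t) Q for 0 <= t <= 1.  With Q > 0 this
    forces every psd supersolution Y >= F Y to dominate every psd fixed point
    X = F X.  For g_l both properties follow from writing it as the minimum over
    gains K of the affine maps
      X |-> (1-l) A X A^T + l (A - K C) X (A - K C)^T + l K R K^T + Q.
    Since g_l decreases with l, V(p) is a supersolution for every larger p, so
    tr V is nonincreasing and the largest feasible p is optimal.  It exists
    because (1 + e) S(p) is a supersolution of the Lyapunov equation at q < p
    close to p, so that tr S cannot drop below M at the supremum. *)

Require Import Defs.
From HB Require Import structures.
From mathcomp Require Import all_boot all_order all_algebra.
From mathcomp Require Import all_classical all_reals.
From mathcomp Require Import complex ring lra.

Set Implicit Arguments.
Unset Strict Implicit.
Unset Printing Implicit Defensive.

Import Order.TTheory GRing.Theory Num.Theory.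
Local Open Scope classical_set_scope.
Local Open Scope ring_scope.

(** * The semidefinite order and comparison of fixed points with supersolutions *)

Section PsdOrder.
Variable R : realType.

Lemma mx_addE n k (X Y : 'M[R]_(n, k)) i j : (X + Y) i j = X i j + Y i j.
Proof. exact: mxE. Qed.

Lemma mx_oppE n k (X : 'M[R]_(n, k)) i j : (- X) i j = - X i j.
Proof. exact: mxE. Qed.

Lemma mx_scaleE n k (a : R) (X : 'M[R]_(n, k)) i j : (a *: X) i j = a * X i j.
Proof. exact: mxE. Qed.

(* Unlike mxE, leaves the entries of matrix products folded, so that they are
   atoms for ring. *)
Definition mx_linE := (mx_addE, mx_oppE, mx_scaleE).

Lemma quad_formD n (X Y : 'M[R]_n) (v : 'cV_n) :
  (v^T *m (X + Y) *m v) ord0 ord0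
  = (v^T *m X *m v) ord0 ord0 + (v^T *m Y *m v) ord0 ord0.
Proof. by rewrite mulmxDr mulmxDl mxE. Qed.

Lemma quad_formZ n (a : R) (X : 'M[R]_n) (v : 'cV_n) :
  (v^T *m (a *: X) *m v) ord0 ord0 = a * (v^T *m X *m v) ord0 ord0.
Proof. by rewrite -scalemxAr -scalemxAl mxE. Qed.

Lemma quad_formB n (X Y : 'M[R]_n) (v : 'cV_n) :
  (v^T *m (X - Y) *m v) ord0 ord0
  = (v^T *m X *m v) ord0 ord0 - (v^T *m Y *m v) ord0 ord0.
Proof. by rewrite quad_formD -scaleN1r quad_formZ mulN1r. Qed.

Lemma psdD n (X Y : 'M[R]_n) : psd X -> psd Y -> psd (X + Y).
Proof.
move=> [sX pX] [sY pY]; split=> [|v]; first by rewrite linearD /= sX sY.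
by rewrite quad_formD addr_ge0.
Qed.

Lemma psdZ n (X : 'M[R]_n) (a : R) : 0 <= a -> psd X -> psd (a *: X).
Proof.
move=> a0 [sX pX]; split=> [|v]; first by rewrite linearZ /= sX.
by rewrite quad_formZ mulr_ge0.
Qed.

Lemma psd_congr n k (B : 'M[R]_(k, n)) (X : 'M[R]_n) :
  psd X -> psd (B *m X *m B^T).
Proof.
move=> [sX pX]; split=> [|v]; first by rewrite !trmx_mul trmxK sX mulmxA.
by have := pX (B^T *m v); rewrite trmx_mul trmxK !mulmxA.
Qed.

Lemma posdef_psd n (X : 'M[R]_n) : posdef X -> psd X.
Proof.
move=> [sX pX]; split=> // v; have [->|/pX/ltW//] := eqVneq v 0.
by rewrite mulmx0 mxE.
Qed.

Lemma psd0 n : psd (0 : 'M[R]_n).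
Proof. by split=> [|v]; rewrite ?trmx0 // mulmx0 mul0mx mxE. Qed.

Lemma loewner_ge_trans n (Y X Z : 'M[R]_n) :
  loewner_ge X Y -> loewner_ge Y Z -> loewner_ge X Z.
Proof. by move=> XY YZ; have := psdD XY YZ; rewrite addrA subrK. Qed.

Lemma psd_tr_ge0 n (X : 'M[R]_n) : psd X -> 0 <= \tr X.
Proof.
move=> [_ pX]; apply: sumr_ge0 => i _; have := pX (delta_mx i ord0).
by rewrite trmx_delta -rowE -colE !mxE.
Qed.

Lemma loewner_ge_tr n (X Y : 'M[R]_n) : loewner_ge X Y -> \tr Y <= \tr X.
Proof. by move/psd_tr_ge0; rewrite linearB /= subr_ge0. Qed.

Lemma posdef_unitmx n (X : 'M[R]_n) : posdef X -> X \in unitmx.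
Proof.
move=> [sX pX]; rewrite -row_free_unit -kermx_eq0; apply/eqP/row_matrixP => i.
rewrite row0; apply/eqP; apply: contraT => ui0.
have: (row i (kermx X))^T != 0 by rewrite -(inj_eq trmx_inj) trmxK trmx0.
move=> /pX; rewrite trmxK -row_mul mulmx_ker row0 mul0mx mxE ltxx //.
Qed.

Lemma sqnorm_ge n (v : 'cV[R]_n) i : v i ord0 ^+ 2 <= (v^T *m v) ord0 ord0.
Proof.
rewrite mxE (bigD1 i) //= mxE -expr2 lerDl sumr_ge0 // => j _.
by rewrite mxE -expr2 sqr_ge0.
Qed.

Lemma quad_form_le n (X : 'M[R]_n) : exists2 K : R, 0 < K &
  forall v : 'cV[R]_n, (v^T *m X *m v) ord0 ord0 <= K * (v^T *m v) ord0 ord0.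
Proof.
(* Each product [v i * v j] is at most [v^T v] in absolute value, by the squares of [v i + v j] and
   [v i - v j]; the summand 1 keeps the constant positive even if [X = 0]. *)
exists (1 + \sum_j \sum_i `|X i j|).
  by rewrite ltr_pwDl // sumr_ge0 // => j _; rewrite sumr_ge0.
move=> v; have v0 : 0 <= (v^T *m v) ord0 ord0.
  by rewrite mxE sumr_ge0 // => i _; rewrite mxE -expr2 sqr_ge0.
rewrite mulrDl mul1r mxE; apply: ler_wpDl => //.
rewrite mulr_suml ler_sum // => j _; rewrite mxE !mulr_suml ler_sum // => i _.
rewrite mxE; apply: le_trans (ler_norm _) _.
rewrite mulrAC normrM mulrC ler_wpM2l //.
have /= vi := sqnorm_ge v i; have /= vj := sqnorm_ge v j.
rewrite ler_norml; apply/andP; split.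
  by have := sqr_ge0 (v i ord0 + v j ord0); nra.
by have := sqr_ge0 (v i ord0 - v j ord0); nra.
Qed.

(* With w = Q^-1 v, expanding 0 <= (v - w/K)^T Q (v - w/K) where
   w^T Q w = v^T Q^-1 v <= K v^T v gives v^T Q v >= v^T v / K; no compactness
   of the sphere is needed. *)
Lemma posdef_coercive n (Q : 'M[R]_n) : posdef Q -> exists2 c : R, 0 < c &
  forall v : 'cV[R]_n, c * (v^T *m v) ord0 ord0 <= (v^T *m Q *m v) ord0 ord0.
Proof.
move=> Qpd; have Qu := posdef_unitmx Qpd; have [sQ pQ] := posdef_psd Qpd.
have [K K0 leK] := quad_form_le (invmx Q).
exists K^-1; rewrite ?invr_gt0 // => v.
have := pQ (v - K^-1 *: (invmx Q *m v)); have := leK v.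
set a := (v^T *m invmx Q *m v) ord0 ord0; set b := (v^T *m v) ord0 ord0.
set q := (v^T *m Q *m v) ord0 ord0 => aKb.
suff -> : ((v - K^-1 *: (invmx Q *m v))^T *m Q *m
   (v - K^-1 *: (invmx Q *m v))) ord0 ord0 = q - K^-1 * b *+ 2 + K^-1 ^+ 2 * a.
  have -> : K^-1 * b *+ 2 = K^-1 * b + K^-1 ^+ 2 * (K * b).
    by field; rewrite gt_eqF.
  have: K^-1 ^+ 2 * a <= K^-1 ^+ 2 * (K * b) by rewrite ler_wpM2l // sqr_ge0.
  by lra.
rewrite [(v - _)^T]linearB /= [(_ *: _)^T]linearZ /= trmx_mul trmx_inv sQ.
rewrite mulmxBl mulmxBr !mulmxBl.
rewrite -!scalemxAl -!scalemxAr mulmxKV //.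
rewrite -[v^T *m Q *m (_ *m _)]mulmxA mulKVmx //.
by rewrite mulmxA !mx_linE -/a -/b -/q; ring.
Qed.

(** Compare both with the identity: [Q >= c I] and [X <= K I], hence [Q >= (c / K) X]. *)
Lemma posdef_dominates n (Q X : 'M[R]_n) : posdef Q -> X^T = X ->
  exists2 c : R, 0 < c & loewner_ge Q (c *: X).
Proof.
move=> Qpd sX; have [c c0 leQ] := posdef_coercive Qpd.
have [K K0 leX] := quad_form_le X; exists (c / K); rewrite ?divr_gt0 //.
split=> [|v]; first by rewrite linearB linearZ /= sX; case: Qpd => ->.
rewrite quad_formB quad_formZ subr_ge0.
apply: le_trans (leQ v); rewrite -mulrA ler_pM2l // mulrC ler_pdivrMr //.
by rewrite mulrC leX.
Qed.

Lemma psd_closed n (X Z : 'M[R]_n) :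
  X^T = X -> (forall e : R, 0 < e -> psd (X + e *: Z)) -> psd X.
Proof.
move=> sX pX; split=> // v; apply/ler_addgt0Pr => e e0.
set z := (v^T *m Z *m v) ord0 ord0.
(* With this step along [Z] the form at [v] changes by at most [e]. *)
have d0 : 0 < e / (1 + `|z|) by rewrite divr_gt0 // ltr_pwDl.
have [_ /(_ v)] := pX _ d0.
rewrite quad_formD quad_formZ -/z.
move=> /le_trans; apply; rewrite lerD2l -mulrA ler_piMr ?(ltW e0) //.
rewrite mulrC ler_pdivrMr ?ltr_pwDl // mul1r.
by rewrite (le_trans (ler_norm z)) // lerDr.
Qed.

(* If Y >= t X with t < 1, then Y >= F Y >= F (t X) >= t X + (1 - t) Q
   >= (t + (1 - t) c) X as soon as Q >= c X; so the largest such t is 1. *)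
Lemma fixpoint_le_supersolution n (F : 'M[R]_n -> 'M[R]_n) (Q X Y : 'M[R]_n) :
    posdef Q -> psd X -> psd Y ->
    (forall U W, psd W -> loewner_ge U W -> loewner_ge (F U) (F W)) ->
    (forall t : R, 0 <= t <= 1 ->
      loewner_ge (F (t *: X)) (t *: X + (1 - t) *: Q)) ->
  loewner_ge Y (F Y) -> loewner_ge Y X.
Proof.
move=> Qpd pX pY Fmono FX YFY.
have [c c0 Qc] := posdef_dominates Qpd pX.1.
pose T := [set t : R | 0 <= t <= 1 /\ loewner_ge Y (t *: X)]%classic.
have T0 : T 0 by split; rewrite ?lexx ?ler01 // /loewner_ge scale0r subr0.
have supT : has_sup T by split; [exists 0|exists 1 => t [/andP[]]].
have s0 : 0 <= sup T by apply: ub_le_sup => //; exact: supT.2.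
have s1 : sup T <= 1 by apply: ge_sup; [exists 0|move=> t [/andP[]]].
have Ys : loewner_ge Y (sup T *: X).
  (* The supremum belongs to [T]: some [t] in [T] exceeds [sup T - e], so
     [Y >= t X >= (sup T - e) X] for every [e > 0]. *)
  apply: (@psd_closed _ _ X) => [|e e0].
    by rewrite linearB linearZ /= pX.1 pY.1.
  have [t [_ Yt] lt_t] := sup_adherent e0 supT.
  have te : 0 <= t - (sup T - e) by lra.
  have := psdD Yt (psdZ te pX).
  by congr (psd _); rewrite !scalerBl opprB !addrA addrNK addrAC.
suff : 1 <= sup T.
  by move=> s1'; move: Ys; have -> : sup T = 1 by [lra|]; rewrite scale1r.
(* [d <= c] gives [Q >= d X]; [d <= 1] keeps the improved factor [sup T + (1 - sup T) d] within
   [0,1]. *)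
rewrite leNgt; apply/negP => lt_s1; pose d := Num.min c 1.
have d0 : 0 < d by rewrite lt_min c0 ltr01.
have dc : d <= c by rewrite ge_min lexx.
have d1 : d <= 1 by rewrite ge_min lexx orbT.
suff : T (sup T + (1 - sup T) * d).
  by move/(ub_le_sup supT.2) => ?; nra.
split; first by apply/andP; split; nra.
apply: (loewner_ge_trans YFY); apply: loewner_ge_trans (Fmono _ _ _ Ys) _.
  exact: psdZ.
apply: (loewner_ge_trans (FX _ _)); first by rewrite s0.
have s1n : 0 <= 1 - sup T by rewrite subr_ge0.
have cd : 0 <= (1 - sup T) * (c - d) by rewrite mulr_ge0 // subr_ge0.
have := psdD (psdZ s1n Qc) (psdZ cd pX); congr (psd _).
by apply/matrixP => i j; rewrite !mx_linE; ring.
Qed.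

End PsdOrder.

(** * The Riccati map as a minimum over gains *)

Section Riccati.
Variables (R : realType) (n m : nat).
Variables (A : 'M[R]_n) (C : 'M[R]_(m, n)) (Q : 'M[R]_n) (Rv : 'M[R]_m).
Hypothesis hR : posdef Rv.
Let riccati := riccati A C Q Rv.

Definition innovation (X : 'M[R]_n) : 'M[R]_m := C *m X *m C^T + Rv.

Definition gain (X : 'M[R]_n) : 'M[R]_(n, m) :=
  A *m X *m C^T *m invmx (innovation X).

(** Expected one-step error covariance when the measurement arrives with probability [l] and is used
    with an arbitrary gain [K]; [gain X] is the Kalman gain. For fixed [K] it is affine in [X]. *)
Definition gain_cost (l : R) (K : 'M[R]_(n, m)) (X : 'M[R]_n) : 'M[R]_n :=
  (1 - l) *: (A *m X *m A^T) + l *: ((A - K *m C) *m X *m (A - K *m C)^T)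
  + l *: (K *m Rv *m K^T) + Q.

Lemma innovation_posdef X : psd X -> posdef (innovation X).
Proof.
move=> pX; have [sX qX] := psd_congr C pX; case: hR => sR qR.
split=> [|v v0]; first by rewrite linearD /= sX sR.
by rewrite quad_formD ltr_wpDl // qR.
Qed.

Lemma gain_innovation X : psd X -> gain X *m innovation X = A *m X *m C^T.
Proof. by move=> pX; exact/mulmxKV/posdef_unitmx/innovation_posdef. Qed.

Lemma riccati_gain l X : psd X ->
  riccati l X = A *m X *m A^T + Q
                - l *: (gain X *m innovation X *m (gain X)^T).
Proof.
move=> pX; rewrite gain_innovation // /riccati /Defs.riccati /gain.
rewrite trmx_mul trmx_inv (innovation_posdef pX).1 !trmx_mul trmxK pX.1.
by rewrite !mulmxA.
Qed.

(** Completing the square in [K] around the Kalman gain. *)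
Lemma gain_costE l K X : psd X ->
  gain_cost l K X
  = riccati l X + l *: ((K - gain X) *m innovation X *m (K - gain X)^T).
Proof.
move=> pX; rewrite riccati_gain // /gain_cost.
have GW := gain_innovation pX.
have WG : innovation X *m (gain X)^T = C *m X *m A^T.
  rewrite -{1}(innovation_posdef pX).1 -trmx_mul GW !trmx_mul trmxK pX.1.
  by rewrite mulmxA.
have -> : (K - gain X) *m innovation X *m (K - gain X)^T =
  K *m (C *m X *m C^T) *m K^T + K *m Rv *m K^T - K *m (C *m X *m A^T)
  - A *m X *m C^T *m K^T + gain X *m innovation X *m (gain X)^T.
  rewrite [(K - _)^T]linearB /= mulmxBl GW mulmxBr !mulmxBl.
  rewrite -[K *m _ *m (gain X)^T]mulmxA WG -GW /innovation.
  rewrite !(mulmxDr K, mulmxDl _ _ K^T).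
  by apply/matrixP => i j; rewrite !mx_linE; ring.
have -> : (A - K *m C) *m X *m (A - K *m C)^T =
  A *m X *m A^T - K *m (C *m X *m A^T) - A *m X *m C^T *m K^T
  + K *m (C *m X *m C^T) *m K^T.
  rewrite [(A - _)^T]linearB /= trmx_mul !(mulmxBl, mulmxBr) !mulmxA.
  by apply/matrixP => i j; rewrite !mx_linE; ring.
by apply/matrixP => i j; rewrite !mx_linE; ring.
Qed.

Lemma psd_quad_innovation X (K : 'M[R]_(n, m)) :
  psd X -> psd (K *m innovation X *m K^T).
Proof. by move=> pX; apply/psd_congr/posdef_psd/innovation_posdef. Qed.

Lemma gain_cost_ge l K X : 0 <= l -> psd X ->
  loewner_ge (gain_cost l K X) (riccati l X).
Proof.
move=> l0 pX; rewrite gain_costE // /loewner_ge addrC addKr.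
exact/psdZ/psd_quad_innovation.
Qed.

Lemma gain_cost_min l X : psd X -> gain_cost l (gain X) X = riccati l X.
Proof. by move=> pX; rewrite gain_costE // subrr !mul0mx scaler0 addr0. Qed.

(** Freeze the gain optimal for [U]: its cost is exact at [U], monotone in between, and an upper
    bound at [W]. *)
Lemma riccati_mono l U W : 0 <= l <= 1 -> psd W -> loewner_ge U W ->
  loewner_ge (riccati l U) (riccati l W).
Proof.
move=> /andP[l0 l1] pW UW.
have pU : psd U by have := psdD UW pW; rewrite subrK.
apply: loewner_ge_trans (gain_cost_ge (gain U) l0 pW).
rewrite -gain_cost_min //; have l1' : 0 <= 1 - l by rewrite subr_ge0.
have := psdD (psdZ l1' (psd_congr A UW))
  (psdZ l0 (psd_congr (A - gain U *m C) UW)).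
congr (psd _); rewrite !(mulmxBr _ U W) ![(_ *m U - _) *m _]mulmxBl /gain_cost.
by apply/matrixP => i j; rewrite !mx_linE; ring.
Qed.

(** For [K] optimal at [t X], affinity splits the cost at [t X] into [t] times the cost at [X] plus
    [(1 - t) (l K R K^T + Q)]; drop the psd term in [K]. *)
Lemma riccati_scale l t X : 0 <= l -> 0 <= t <= 1 -> psd X ->
  loewner_ge (riccati l (t *: X)) (t *: riccati l X + (1 - t) *: Q).
Proof.
move=> l0 /andP[t0 t1] pX; have ptX := psdZ t0 pX.
have t1' : 0 <= 1 - t by rewrite subr_ge0.
rewrite -gain_cost_min //; set K := gain _.
have := psdD (psdZ t0 (gain_cost_ge K l0 pX))
  (psdZ (mulr_ge0 t1' l0) (psd_congr K (posdef_psd hR))).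
congr (psd _); rewrite /gain_cost -!scalemxAr -!scalemxAl.
by apply/matrixP => i j; rewrite !mx_linE; ring.
Qed.

Lemma riccati_anti l l' X : l <= l' -> psd X ->
  loewner_ge (riccati l X) (riccati l' X).
Proof.
move=> ll' pX; rewrite /loewner_ge !riccati_gain // opprB addrC addrA addrNK.
rewrite -scalerBl; apply: psdZ; first by rewrite subr_ge0.
exact: psd_quad_innovation.
Qed.

Lemma riccati_fixpoint_anti l l' X Y : posdef Q -> 0 <= l' <= 1 -> l <= l' ->
  psd X -> X = riccati l' X -> psd Y -> Y = riccati l Y -> loewner_ge Y X.
Proof.
move=> Qpd l'01 ll' pX eX pY eY.
apply: (fixpoint_le_supersolution (F := riccati l') Qpd) => //.
- by move=> U W; exact: riccati_mono.
- move=> t t01; rewrite {2}eX; apply: riccati_scale => //.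
  by case/andP: l'01.
- by rewrite {1}eY; exact: riccati_anti.
Qed.

End Riccati.

Lemma lyapunov_fixpoint_le (R : realType) n (A Q X Y : 'M[R]_n) (a : R) :
    posdef Q -> 0 <= a -> psd X -> X = a *: (A *m X *m A^T) + Q ->
    psd Y -> loewner_ge Y (a *: (A *m Y *m A^T) + Q) ->
  loewner_ge Y X.
Proof.
move=> Qpd a0 pX eX pY.
apply: (fixpoint_le_supersolution (F := fun Z => a *: (A *m Z *m A^T) + Q)
  Qpd) => // [U W _ UW|t _].
  rewrite /loewner_ge opprD addrACA subrr addr0 -scalerBr -mulmxBl -mulmxBr.
  exact/psdZ/psd_congr.
(* The map is affine with constant term [Q], so here the scaling inequality is an equality. *)
suff -> : a *: (A *m (t *: X) *m A^T) + Q = t *: X + (1 - t) *: Q.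
  by rewrite /loewner_ge subrr; exact: psd0.
rewrite -scalemxAr -scalemxAl {2}eX.
by apply/matrixP => i j; rewrite !mx_linE; ring.
Qed.

(** * The feasible set contains its supremum *)

Section Feasible.
Variables (R : realType) (n : nat) (A Q : 'M[R]_n).
Variables (p2 M : R) (S : R -> 'M[R]_n).

Lemma p_lower_gt0 : 1 < spectral_radius A -> 0 < p_lower A.
Proof.
move=> hA; rewrite /p_lower subr_gt0 invf_lt1 ?exprn_gt0 ?(lt_trans ltr01) //.
by rewrite expr_gt1 // ltW // (lt_trans ltr01).
Qed.

Hypotheses (hA : 1 < spectral_radius A) (hQ : posdef Q).
Hypotheses (hp2 : 0 <= p2 <= 1) (hS : lyapunov_family A Q p2 S).

Lemma feasible_has_sup : has_sup (feasible A p2 S M).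
Proof.
split; last by exists 1 => p [/andP[]].
(* At [p = 0] the bound is infinite, since [p_lower A > 0]. *)
exists 0; split; first by rewrite lexx ler01.
by rewrite /trS mul0r ltNge (ltW (p_lower_gt0 hA)) /= leey.
Qed.

(* (1 + e) S(p) is a supersolution of the Lyapunov equation at every q
   slightly below p, which bounds S(q) from above. *)
Lemma trS_left_usc p : 0 <= p <= 1 -> p_lower A < p * p2 -> \tr (S p) < M ->
  exists2 d : R, 0 < d & forall q, 0 <= q -> q <= p -> p - d < q ->
    ~ feasible A p2 S M q.
Proof.
move=> p01 pl ltM; have [Spd eS] := hS p01 pl; have pS := posdef_psd Spd.
have /andP[p20 p21] := hp2; have /andP[p0 p1] := p01.
set T := \tr (S p) in ltM; have T0 : 0 <= T := psd_tr_ge0 pS.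
(* The denominator is [T + 1] because [T] may vanish; then [e T < M - T]. *)
have [e e0 eM] : exists2 e : R, 0 < e & (1 + e) * T < M.
  exists ((M - T) / (T + 1)); first by rewrite divr_gt0 ?subr_gt0 // ltr_wpDl.
  have : (M - T) / (T + 1) * (T + 1) = M - T.
    by rewrite divfK // gt_eqF // ltr_wpDl.
  by nra.
have pASA := psd_congr A pS.
have [c c0 Qc] := posdef_dominates hQ pASA.1.
(* The first bound gives [(1 + e) (p - q) p2 <= e c]; the second keeps [q p2] above [p_lower A],
   where [S q] solves its equation. *)
exists (Num.min (e * c / (1 + e)) (p * p2 - p_lower A)).
  by rewrite lt_min subr_gt0 pl andbT divr_gt0 ?mulr_gt0 ?addr_gt0.
move=> q q0 qp; rewrite ltrBlDl -ltrBlDr lt_min => /andP[dq plq] [q01].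
have pq0 : 0 <= (p - q) * p2 by rewrite mulr_ge0 // subr_ge0.
have pqd : (p - q) * p2 <= p - q by rewrite ler_piMr // subr_ge0.
have plq' : p_lower A < q * p2 by nra.
rewrite /trS plq' lee_fin; apply/negP; rewrite -ltNge.
have [Sqpd eSq] := hS q01 plq'.
apply: le_lt_trans eM; rewrite -[_ * T]linearZ /=; apply: loewner_ge_tr.
have e1 : 0 <= 1 + e by rewrite addr_ge0 // ltW.
have qp2 : 0 <= 1 - q * p2 by nra.
apply: (lyapunov_fixpoint_le hQ qp2 (posdef_psd Sqpd) eSq (psdZ e1 pS)).
(* The residual of [(1 + e) S(p)] at [q] is [e Q - (1 + e) (p - q) p2 A S(p) A^T], that is
   [e (Q - c A S(p) A^T)] plus this gap times [A S(p) A^T]. *)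
have gap : 0 <= e * c - (1 + e) * ((p - q) * p2).
  move: dq; rewrite ltr_pdivlMr ?addr_gt0 // => dq; nra.
have := psdD (psdZ (ltW e0) Qc) (psdZ gap pASA).
congr (psd _); rewrite -scalemxAr -scalemxAl [X in _ = _ *: X - _]eS.
by apply/matrixP => i j; rewrite !mx_linE; ring.
Qed.

Lemma feasible_sup : feasible A p2 S M (sup (feasible A p2 S M)).
Proof.
have hsup := feasible_has_sup; set p := sup _.
have p01 : 0 <= p <= 1.
  apply/andP; split.
    have [q Fq] := hsup.1; apply: le_trans (ub_le_sup hsup.2 Fq).
    by case: Fq => /andP[].
  by apply: ge_sup hsup.1 _ => q [/andP[]].
split=> //; rewrite /trS; case: ifPn => [pl|_]; last by rewrite leey.
rewrite lee_fin leNgt; apply/negP => ltM.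
have [d d0 infeas] := trS_left_usc p01 pl ltM.
have [q Fq ltq] := sup_adherent d0 hsup.
apply: (infeas q _ _ ltq) => //; last exact: (ub_le_sup hsup.2 Fq).
by case: Fq => /andP[].
Qed.

End Feasible.

Theorem theorem5 (R : realType) (n m : nat)
  (A : 'M[R]_n) (C : 'M[R]_(m, n)) (Q Qh : 'M[R]_n) (Rv : 'M[R]_m)
  (p1 p2 M : R) (S V : R -> 'M[R]_n)
  (hA : 1 < spectral_radius A)
  (hQ : posdef Q) (hR : posdef Rv)
  (hQh : psd_sqrt Qh Q) (hstab : stabilizable A Qh) (hdet : detectable A C)
  (hp1 : 0 <= p1 <= 1) (hp2 : 0 <= p2 <= 1)
  (hS : lyapunov_family A Q p2 S)
  (hV : riccati_family A C Q Rv p1 V)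
  (hM : 0 < M) :
  exists pstar : R,
    [/\ feasible A p2 S M pstar,
        (forall p : R, feasible A p2 S M p -> p <= pstar) &
        (forall p : R, feasible A p2 S M p ->
           (trV A C Q Rv p1 V pstar <= trV A C Q Rv p1 V p)%E)].
Proof.
have ub := ub_le_sup (feasible_has_sup p2 M S hA).2.
have Fs := feasible_sup M hA hQ hp2 hS.
exists (sup (feasible A p2 S M)); split=> // p Fp; have le_ps := ub _ Fp.
have [p01 _] := Fp; have [s01 _] := Fs; have /andP[p10 p11] := hp1.
rewrite [leRHS]/trV; case: ifPn => [pu|_]; last by rewrite leey.
(* Finiteness of the bound at [p] passes to the larger supremum, so both Riccati equations are
   available. *)
have le_pps : p * p1 <= sup (feasible A p2 S M) * p1 by rewrite ler_wpM2r.
have su := lt_le_trans pu le_pps; rewrite /trV su lee_fin.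
apply: loewner_ge_tr.
have [Vpd eV] := hV _ p01 pu; have [Vspd eVs] := hV _ s01 su.
have l01 : 0 <= sup (feasible A p2 S M) * p1 <= 1.
  by case/andP: s01 => s0 s1; rewrite mulr_ge0 //= mulr_ile1.
apply: (riccati_fixpoint_anti hR hQ l01 le_pps _ eVs _ eV); exact: posdef_psd.
Qed.
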